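(* Let $c \in \mathbb{Z}$, let $L_c$ be the splitting field over $\mathbb{Q}$ of $(x^2+c)^2+c$, let $\mathfrak{B}$ be a prime of $\mathcal{O}_{L_c}$ above $2$, and let $(G_i)_{i\geq 0}$ be the (lower numbering) ramification filtration of $\mathrm{Gal}(L_c/\mathbb{Q})$ at $\mathfrak{B}$. If $c \equiv 1 \pmod 4$, then $\#G_0 = \#G_1 = 8$, $\#G_2 = \#G_3 = 4$, $\#G_4 = \#G_5 = 2$, and $\#G_i = 1$ for $i \geq 6$. If $c = 2^{2k+1}m$ with $k \geq 1$ and $m$ odd, then $\#G_0 = \#G_1 = 8$, $\#G_2 = \#G_3 = 4$, $\#G_i = 2$ for $4 \leq i \leq 7$, and $\#G_i = 1$ for $i \geq 8$.
   Context: For $i \geq 0$, $G_i = \{\sigma \in \mathrm{Gal}(L_c/\mathbb{Q}) : \sigma(\mathfrak{B}) = \mathfrak{B} \text{ and } v_{\mathfrak{B}}(\sigma(x) - x) \geq i+1 \text{ for all } x \in \mathcal{O}_{L_c}\}$, where $v_{\mathfrak{B}}$ is the normalized $\mathfrak{B}$-adic valuation on $L_c$ and $\mathcal{O}_{L_c}$ is the ring of integers of $L_c$. *)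

(* Defs.v *)
From HB Require Import structures.
From mathcomp Require Import all_boot all_order all_algebra all_fingroup all_solvable all_field.
From mathcomp Require Import boolp.
Set Implicit Arguments. Unset Strict Implicit. Unset Printing Implicit Defensive.
Import GRing.Theory.
Local Open Scope ring_scope.

Definition fc (c : int) : {poly rat} := ('X ^+ 2 + (c%:~R)%:P) ^+ 2 + (c%:~R)%:P.

Section RamificationDefs.
Variable L : splittingFieldType rat.

Definition OL (x : L) : Prop :=
  exists p : {poly int}, p \is monic /\ root (map_poly (intr : int -> L) p) x.

Definition prime_ideal_above2 (B : L -> Prop) : Prop :=
  (forall x, B x -> OL x) /\
  B 0 /\
  (forall x y, B x -> B y -> B (x + y)) /\
  (forall x y, OL x -> B y -> B (x * y)) /\
  ~ B 1 /\
  (forall x y, OL x -> OL y -> B (x * y) -> B x \/ B y) /\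
  B 2.

Inductive idealpow (B : L -> Prop) : nat -> L -> Prop :=
| idealpow0 x : OL x -> idealpow B 0 x
| idealpowS0 n : idealpow B n.+1 0
| idealpowD n x y : idealpow B n.+1 x -> idealpow B n.+1 y -> idealpow B n.+1 (x + y)
| idealpowM n a b : B a -> idealpow B n b -> idealpow B n.+1 (a * b).

Definition vB_ge (B : L -> Prop) (y : L) (n : nat) : Prop := idealpow B n y.

Definition ram_group (B : L -> Prop) (i : nat) : {set gal_of {:L}} :=
  [set s in ('Gal({:L} / 1%VS))%g |
     `[< (forall y, B y <-> exists x, B x /\ s x = y) /\
         (forall x, OL x -> vB_ge B (s x - x) i.+1) >] ].

End RamificationDefs.

(* Main.v *)
Require Import Defs.
From HB Require Import structures.
From mathcomp Require Import all_boot all_order all_algebra all_fingroup all_solvable all_field.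
From mathcomp Require Import boolp.
From mathcomp Require Import ring zify.
Import Order.TTheory GRing.Theory Num.Theory.
Local Open Scope ring_scope.
Set Implicit Arguments.
Unset Strict Implicit.

(* Localizing OL at B gives a ring which is integrally closed, and this alone
   yields a usable valuation: "x has valuation n" is read as "x^8 / 2^n is a
   unit", the ramification index being 8, and valuations of explicit elements
   then come from extracting roots and from factorizations p q whose factors
   differ by little.  With s^2 = -c, a^2 = s - c, b^2 = -s - c, an element of
   odd valuation is
     a - b + s - s^2                  (valuation 7) if c = 1 mod 4,
     a' - (a'/b' - 1)/s' + 1          (valuation 3) if c = 2^(2k+1) m,
   where s' = s/2^k, a' = a/s'^k, b' = b/(-s')^k.  It yields a uniformizer pi; the
   powers pi^0, ..., pi^7 have valuations distinct modulo 8, hence are linearly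
   independent, and as [L : Q] <= 8 they form a Q-basis of L.  So the Galois
   group is the full dihedral group, and g lies in G_i exactly when g pi - pi
   has valuation at least i + 1. *)

(** * Localization at a prime above 2 *)

Section Localization.
Context {L : splittingFieldType rat}.

Lemma natL_neq0 n : (n.+1%:R : L) != 0.
Proof.
rewrite -[n.+1%:R]/(1 *+ n.+1) -(scale1r (1 : L)) scalerMnl scaler_eq0 oner_eq0.
by rewrite orbF pnatr_eq0.
Qed.

Lemma two_neq0 : (2 : L) != 0. Proof. exact: natL_neq0. Qed.

Lemma OL_integral (x : L) : OL x <-> integralOver (intr : int -> L) x.
Proof. by split; [case=> p [] | case=> p]; exists p. Qed.

Lemma OL_int (z : int) : OL (z%:~R : L).
Proof. exact/OL_integral/integral_id. Qed.

Lemma OL_nat n : OL (n%:R : L).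
Proof. by rewrite -[n%:R]/((n%:Z)%:~R); apply: OL_int. Qed.

Lemma OL_add (x y : L) : OL x -> OL y -> OL (x + y).
Proof. by move=> /OL_integral x_int /OL_integral y_int; apply/OL_integral/integral_add. Qed.

Lemma OL_mul (x y : L) : OL x -> OL y -> OL (x * y).
Proof. by move=> /OL_integral x_int /OL_integral y_int; apply/OL_integral/integral_mul. Qed.

Lemma OL_opp (x : L) : OL x -> OL (- x).
Proof. by move=> /OL_integral x_int; apply/OL_integral/integral_opp. Qed.

Lemma OL_exp (x : L) n : OL x -> OL (x ^+ n).
Proof.
move=> OLx; elim: n => [|n IHn]; first by rewrite expr0; apply: (OL_nat 1).
by rewrite exprS; apply: OL_mul.
Qed.

Lemma OL_root_monic (u : L) (p : {poly L}) :
  p \is monic -> root p u -> (forall i, OL p`_i) -> OL u.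
Proof.
move=> p_monic pu0 OLp; apply/OL_integral; apply: (integral_root_monic p_monic pu0).
by apply/integral_poly => i; apply/OL_integral.
Qed.

Lemma OL_rootn (x : L) n : (0 < n)%N -> OL (x ^+ n) -> OL x.
Proof.
move=> n_gt0 OLxn; apply: (@OL_root_monic _ ('X^n - (x ^+ n)%:P)).
- exact: monicXnsubC.
- by rewrite /root !hornerE subrr.
move=> i; rewrite coefB coefXn coefC; apply: OL_add; first exact: OL_nat.
by apply: OL_opp; case: eqP => _ //; apply: (OL_nat 0).
Qed.

Lemma OL_quadratic (x p q : L) : OL p -> OL q -> x ^+ 2 = p * x - q -> OL x.
Proof.
move=> OLp OLq Dx; apply: (@OL_root_monic _ ('X^2 - (p *: 'X - q%:P))).
- rewrite monicE lead_coefDl ?lead_coefXn // size_polyXn size_polyN.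
  rewrite (leq_ltn_trans (size_polyD _ _)) // size_polyN gtn_max.
  by rewrite (leq_ltn_trans (size_scale_leq _ _)) ?size_polyX // size_polyC; case: (q != 0).
- by rewrite /root !hornerE Dx subrr.
move=> i; rewrite !coefB coefXn coefZ coefX coefC; apply: OL_add; first exact: OL_nat.
apply/OL_opp/OL_add; first exact/OL_mul/OL_nat.
by apply: OL_opp; case: eqP => _ //; apply: (OL_nat 0).
Qed.

Variable B : L -> Prop.
Hypothesis hB : prime_ideal_above2 B.

Let B_OL x : B x -> OL x. Proof. by case: hB => H _; apply: H. Qed.
Let B0 : B 0. Proof. by case: hB => _ []. Qed.
Let BD x y : B x -> B y -> B (x + y). Proof. by case: hB => _ [_ [H _]]; apply: H. Qed.
Let BM x y : OL x -> B y -> B (x * y). Proof. by case: hB => _ [_ [_ [H _]]]; apply: H. Qed.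
Let B1 : ~ B 1. Proof. by case: hB => _ [_ [_ [_ []]]]. Qed.
Let B_prime x y : OL x -> OL y -> B (x * y) -> B x \/ B y.
Proof. by case: hB => _ [_ [_ [_ [_ [H _]]]]]; apply: H. Qed.
Let B2 : B 2. Proof. by case: hB => _ [_ [_ [_ [_ []]]]]. Qed.

Let BN x : B x -> B (- x).
Proof. by move=> Bx; rewrite -mulN1r; apply: BM => //; apply/OL_opp/(OL_nat 1). Qed.

Let nB_mul x y : OL x -> OL y -> ~ B x -> ~ B y -> ~ B (x * y).
Proof. by move=> OLx OLy nBx nBy /B_prime[]. Qed.

Let nB_exp x n : OL x -> ~ B x -> ~ B (x ^+ n).
Proof.
move=> OLx nBx; elim: n => // n IHn; rewrite exprS.
by apply: nB_mul => //; apply: OL_exp.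
Qed.

Let nB_neq0 q : ~ B q -> q != 0.
Proof. by move=> nBq; apply/eqP => q0; apply: nBq; rewrite q0. Qed.

Definition loc (x : L) : Prop := exists p q, [/\ OL p, OL q, ~ B q & x = p / q].

Lemma loc_OL x : OL x -> loc x.
Proof. by exists x, 1; rewrite divr1; split=> //; apply: (OL_nat 1). Qed.

Lemma loc_nat n : loc n%:R. Proof. exact/loc_OL/OL_nat. Qed.

Lemma loc_add x y : loc x -> loc y -> loc (x + y).
Proof.
move=> [p [q [OLp OLq nBq ->]]] [p' [q' [OLp' OLq' nBq' ->]]].
exists (p * q' + p' * q), (q * q'); split.
- by apply: OL_add; apply: OL_mul.
- exact: OL_mul.
- exact: nB_mul.
by field; rewrite !nB_neq0.
Qed.

Lemma loc_mul x y : loc x -> loc y -> loc (x * y).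
Proof.
move=> [p [q [OLp OLq nBq ->]]] [p' [q' [OLp' OLq' nBq' ->]]].
exists (p * p'), (q * q'); split; [exact: OL_mul | exact: OL_mul | exact: nB_mul |].
by field; rewrite !nB_neq0.
Qed.

Lemma loc_exp x n : loc x -> loc (x ^+ n).
Proof.
move=> Rx; elim: n => [|n IHn]; first by rewrite expr0; apply: (loc_nat 1).
by rewrite exprS; apply: loc_mul.
Qed.

Lemma loc_sum (I : Type) (r : seq I) (P : pred I) (F : I -> L) :
  (forall i, P i -> loc (F i)) -> loc (\sum_(i <- r | P i) F i).
Proof. by move=> RF; elim/big_ind: _ => //; [apply: (loc_nat 0) | apply: loc_add]. Qed.

(** Integral closedness is inherited from that of O_L: if x^(n+1) = p / q, then (x q)^(n+1) = p q^n
    is an algebraic integer, hence so is x q. *)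
Lemma loc_rootn x n : (0 < n)%N -> loc (x ^+ n) -> loc x.
Proof.
case: n => // n _ [p [q [OLp OLq nBq Dx]]]; have q0 := nB_neq0 nBq.
exists (x * q), q; split=> //; last by rewrite mulfK.
apply: (@OL_rootn _ n.+1) => //; rewrite exprMn Dx exprS mulrA divfK //.
by apply: OL_mul => //; apply: OL_exp.
Qed.

(** The equation says x + 1/x = r. With r = p / q, the element x q is a root of the monic polynomial
    X^2 - p X + q^2. This is how a quotient is shown to be a unit without computing it. *)
Lemma loc_quadratic x r : loc r -> x ^+ 2 = r * x - 1 -> loc x.
Proof.
move=> [p [q [OLp OLq nBq ->]]] Dx; have q0 := nB_neq0 nBq.
exists (x * q), q; split=> //; last by rewrite mulfK.
apply: (@OL_quadratic _ p (q ^+ 2)) => //; first exact: OL_exp.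
by rewrite exprMn Dx; field.
Qed.

(** * A valuation normalized by v(2) = 8 *)

Definition val_ge (x : L) (n : int) : Prop := loc (x ^+ 8 * 2 ^ (- n)).
(** The bound on the inverse encodes v(x) <= n. The relation does not presuppose that 2 has
    ramification index 8: until a uniformizer is available, a nonzero x is not known to satisfy
    [val_eq x n] for some integer n. *)
Definition val_eq (x : L) (n : int) : Prop := [/\ x != 0, val_ge x n & val_ge x^-1 (- n)].

Let exp2D m n : (2 : L) ^ (m + n) = 2 ^ m * 2 ^ n.
Proof. by rewrite expfzDr // two_neq0. Qed.

Let exp2X m n : ((2 : L) ^ m) ^+ n = 2 ^ (m * n%:Z).
Proof. by rewrite -exprz_exp. Qed.

Lemma loc_exp2 (n : int) : 0 <= n -> loc (2 ^ n).
Proof. by case: n => // n _; apply/loc_exp/(loc_nat 2). Qed.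

Lemma loc_val_ge0 x : loc x -> val_ge x 0.
Proof. by rewrite /val_ge oppr0 expr0z mulr1; apply: loc_exp. Qed.

Lemma val_ge0_loc x : val_ge x 0 -> loc x.
Proof. by rewrite /val_ge oppr0 expr0z mulr1; apply: loc_rootn. Qed.

Lemma val_ge_zero n : val_ge 0 n.
Proof. by rewrite /val_ge expr0n mul0r; apply: (loc_nat 0). Qed.

Lemma val_ge_le x n m : m <= n -> val_ge x n -> val_ge x m.
Proof.
move=> le_mn Rx; rewrite /val_ge (_ : - m = - n + (n - m)); last by lia.
by rewrite exp2D mulrA; apply: loc_mul => //; apply: loc_exp2; lia.
Qed.

Lemma val_ge_mul x y m n : val_ge x m -> val_ge y n -> val_ge (x * y) (m + n).
Proof.
move=> Rx Ry; rewrite /val_ge opprD exp2D exprMn.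
by rewrite mulrACA; apply: loc_mul.
Qed.

Lemma val_ge_loc x y n : loc x -> val_ge y n -> val_ge (x * y) n.
Proof. by move=> /loc_val_ge0 Rx /(val_ge_mul Rx); rewrite add0r. Qed.

Lemma val_ge_opp x n : val_ge x n -> val_ge (- x) n.
Proof. by rewrite /val_ge (_ : (- x) ^+ 8 = x ^+ 8); last by ring. Qed.

(** In the binomial expansion of (x + y)^8 / 2^n, the eighth power of the monomial x^(8-i) y^i / 2^n
    is (x^8 / 2^n)^(8-i) (y^8 / 2^n)^i. Extracting the eighth root puts each monomial in the
    localization. *)
Lemma val_ge_add x y n : val_ge x n -> val_ge y n -> val_ge (x + y) n.
Proof.
move=> Rx Ry; rewrite /val_ge exprDn mulr_suml; apply: loc_sum => [[i /= lti9]] _.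
rewrite -mulrnAl -mulr_natl -!mulrA; apply: loc_mul; first exact: loc_nat.
apply: (@loc_rootn _ 8) => //.
have -> : (x ^+ (8 - i) * (y ^+ i * 2 ^ (- n))) ^+ 8
        = (x ^+ 8 * 2 ^ (- n)) ^+ (8 - i) * (y ^+ 8 * 2 ^ (- n)) ^+ i.
  rewrite (exprMn (8 - i)%N (x ^+ 8)) (exprMn i (y ^+ 8)) (exprMn 8 (x ^+ (8 - i))).
  by rewrite (exprMn 8 (y ^+ i)) -!exprM -!(mulnC 8%N) mulrACA -exprD subnK // mulrA.
by apply: loc_mul; apply: loc_exp.
Qed.

Lemma val_ge_sub x y n : val_ge x n -> val_ge y n -> val_ge (x - y) n.
Proof. by move=> Rx /val_ge_opp; apply: val_ge_add. Qed.

Lemma val_ge_rootn x n k : (0 < k)%N -> val_ge (x ^+ k) (n * k%:Z) -> val_ge x n.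
Proof.
move=> k_gt0 Rx; apply: (loc_rootn k_gt0).
by rewrite exprMn exp2X mulNr -exprM mulnC exprM.
Qed.

Lemma val_eq_ge x n : val_eq x n -> val_ge x n. Proof. by case. Qed.
Lemma val_eq_neq0 x n : val_eq x n -> x != 0. Proof. by case. Qed.

Lemma val_eq_mul x y m n : val_eq x m -> val_eq y n -> val_eq (x * y) (m + n).
Proof.
move=> [x0 Rx Rx'] [y0 Ry Ry']; split; first by rewrite mulf_neq0.
  exact: val_ge_mul.
by rewrite invfM opprD; apply: val_ge_mul.
Qed.

Lemma val_eq_inv x n : val_eq x n -> val_eq x^-1 (- n).
Proof. by move=> [x0 Rx Rx']; split; rewrite ?invr_eq0 ?invrK ?opprK. Qed.

Lemma val_eq_div x y m n : val_eq x m -> val_eq y n -> val_eq (x / y) (m - n).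
Proof. by move=> Vx /val_eq_inv; apply: val_eq_mul. Qed.

Lemma val_eq_opp x n : val_eq x n -> val_eq (- x) n.
Proof.
move=> [x0 Rx Rx']; split; rewrite ?oppr_eq0 ?invrN //; exact: val_ge_opp.
Qed.

Lemma val_eq1 : val_eq 1 0.
Proof.
split; rewrite ?oner_eq0 ?invr1 ?oppr0 //; apply/loc_val_ge0/(loc_nat 1).
Qed.

Lemma val_eq_exp x n k : val_eq x n -> val_eq (x ^+ k) (n * k%:Z).
Proof.
move=> Vx; elim: k => [|k IHk]; first by rewrite mulr0; apply: val_eq1.
by rewrite exprS intS mulrDr mulr1; apply: val_eq_mul.
Qed.

Lemma val_eq_rootn x n k : (0 < k)%N -> val_eq (x ^+ k) (n * k%:Z) -> val_eq x n.
Proof.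
move=> k_gt0 [x0 Rx Rx']; split; first by move: x0; rewrite expf_eq0 k_gt0.
  exact: val_ge_rootn Rx.
by apply: (val_ge_rootn k_gt0); rewrite exprVn mulNr.
Qed.

Lemma val_eq2 : val_eq 2 8.
Proof.
split; first exact: two_neq0.
  by rewrite /val_ge -[2 ^+ 8]/((2 : L) ^ 8%:Z) -exp2D; apply: (loc_nat 1).
rewrite /val_ge exprVn -[(2 ^+ 8)^-1]/((2 : L) ^ (- 8%:Z)) -exp2D.
exact: (loc_nat 1).
Qed.

(** If x^8 / 2 = p / q with q outside B, then x^8 q = 2 p lies in B, and primality leaves only x in
    B. *)
Lemma val_ge_B x : OL x -> val_ge x 1 -> B x.
Proof.
move=> OLx [p [q [OLp OLq nBq Dx]]].
have Bxq : B (x ^+ 8 * q).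
  have -> : x ^+ 8 * q = p * 2.
    have {}Dx : x ^+ 8 / 2 = p / q by exact: Dx.
    by rewrite -[x ^+ 8](divfK two_neq0) Dx; field; apply: nB_neq0.
  exact: BM.
have [Bx8|//] := B_prime (OL_exp 8 OLx) OLq Bxq.
case: (pselect (B x)) => // nBx; by case: (@nB_exp x 8 OLx nBx).
Qed.

(** Write z = p / q. Then p lies in B, so q + p stays outside B, and 1 + z = (q + p) / q is
    invertible in the localization. *)
Lemma val_eq_unit z : val_ge z 1 -> val_eq (1 + z) 0.
Proof.
move=> Rz; have /val_ge0_loc[p [q [OLp OLq nBq Dz]]] : val_ge z 0 by apply: (val_ge_le _ Rz).
have q0 := nB_neq0 nBq.
have Bp : B p.
  apply: (val_ge_B OLp); rewrite -[p](divfK q0) -Dz mulrC.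
  by apply: val_ge_loc => //; apply: loc_OL.
have nBqp : ~ B (q + p).
  by move=> Bqp; apply: nBq; rewrite -[q](addrK p); apply/BD/BN.
have D1z : 1 + z = (q + p) / q by rewrite Dz; field.
have OLqp : OL (q + p) by apply: OL_add.
split.
- by rewrite D1z mulf_neq0 ?invr_eq0 // nB_neq0.
- by apply: loc_val_ge0; exists (q + p), q.
by rewrite oppr0; apply: loc_val_ge0; exists q, (q + p); split=> //; rewrite D1z invf_div.
Qed.

Lemma val_eq_addl x y n m : n < m -> val_eq x n -> val_ge y m -> val_eq (x + y) n.
Proof.
move=> lt_nm Vx Ry; have x0 := val_eq_neq0 Vx.
have -> : x + y = x * (1 + x^-1 * y) by field.
rewrite -[n]addr0; apply: (val_eq_mul Vx); apply: val_eq_unit.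
case: Vx => _ _ /val_ge_mul/(_ Ry); apply: val_ge_le; lia.
Qed.

Lemma val_eq_addr x y n m : n < m -> val_eq y n -> val_ge x m -> val_eq (x + y) n.
Proof. by rewrite addrC; apply: val_eq_addl. Qed.

(** If m > n, then x - x would have valuation n by the ultrametric equality, and in particular would
    be nonzero. *)
Lemma val_ge_eq_le x m n : val_eq x n -> val_ge x m -> m <= n.
Proof.
move=> Vx Rx; case: (lerP m n) => // lt_nm.
have := val_eq_addl lt_nm Vx (val_ge_opp Rx).
by rewrite subrr => /val_eq_neq0; rewrite eqxx.
Qed.

(* p/q + q/p = (p - q)^2/(pq) + 2 is integral over the localization, so p/q is a unit. *)
Lemma val_eq_factor p q n : val_eq (p * q) (n + n) -> val_ge (p - q) n -> val_eq p n.
Proof.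
move=> Vpq Rd; have pq0 := val_eq_neq0 Vpq.
have p0 : p != 0 by apply: contraNneq pq0 => ->; rewrite mul0r.
have q0 : q != 0 by apply: contraNneq pq0 => ->; rewrite mulr0.
have Rr : loc ((p - q) * (p - q) * (p * q)^-1 + 2).
  apply: loc_add; last exact: (loc_nat 2).
  case: Vpq => _ _ Rpq; apply: val_ge0_loc; rewrite -[0](subrr (n + n)).
  by apply: val_ge_mul => //; apply: val_ge_mul.
have Vpdq : val_eq (p / q) 0.
  split; first by rewrite mulf_neq0 ?invr_eq0.
    by apply: loc_val_ge0; apply: (loc_quadratic Rr); field; rewrite ?p0 ?q0.
  by rewrite oppr0; apply: loc_val_ge0; apply: (loc_quadratic Rr); field; rewrite ?p0 ?q0.
apply: (@val_eq_rootn _ _ 2) => //.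
have -> : p ^+ 2 = p * q * (p / q) by field.
have -> : n * 2%:Z = n + n + 0 by lia.
exact: val_eq_mul.
Qed.

(** * Valuations of integers and rationals *)

Lemma val_ge_int (z : int) : val_ge z%:~R 0.
Proof. exact/loc_val_ge0/loc_OL/OL_int. Qed.

Lemma val_eq_odd (z : int) : odd `|z|%N -> val_eq z%:~R 0.
Proof.
move=> z_odd; have [w ->] : exists w, z = 1 + 2 * w by exists (z %/ 2)%Z; lia.
rewrite rmorphD rmorphM /=; apply: val_eq_unit.
have := val_ge_mul (val_eq_ge val_eq2) (val_ge_int w); apply: val_ge_le; lia.
Qed.

Lemma val_eq_int (z : int) : z != 0 ->
  exists k : nat, val_eq z%:~R (8 * k%:Z).
Proof.
elim: {z}`|z|%N {-2}z (leqnn `|z|%N) => [|n IHn] z le_zn z0; first by lia.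
case z_odd: (odd `|z|%N); first by exists 0%N; rewrite mulr0; apply: val_eq_odd.
have [w Dz] : exists w, z = 2 * w by exists (z %/ 2)%Z; lia.
have [||k Vw] := IHn w; [lia | lia |].
exists k.+1; rewrite Dz rmorphM /= (_ : 8 * k.+1%:Z = 8 + 8 * k%:Z); last by lia.
exact: (val_eq_mul val_eq2).
Qed.

Lemma val_ge_even (z : int) : ~~ odd `|z|%N -> val_ge z%:~R 8.
Proof.
move=> z_even; have [w ->] : exists w, z = 2 * w by exists (z %/ 2)%Z; lia.
by rewrite rmorphM; apply: (val_ge_mul (val_eq_ge val_eq2) (val_ge_int w)).
Qed.

Lemma alg_ratE (a : rat) : a%:A = (numq a)%:~R / (denq a)%:~R :> L.
Proof.
by rewrite -[a in LHS]divq_num_den -[_%:A]/(in_alg L _) fmorph_div !rmorph_int.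
Qed.

Lemma val_eq_rat (a : rat) : a != 0 -> exists k : int, val_eq (a%:A : L) (8 * k).
Proof.
move=> a0; rewrite alg_ratE.
have [|k Vn] := @val_eq_int (numq a); first by rewrite numq_eq0.
have [l Vd] := @val_eq_int (denq a) (denq_neq0 a).
by exists (k%:Z - l%:Z); rewrite mulrBr; apply: val_eq_div.
Qed.

(** On rationals the residue field is F_2. An even denominator would force the odd numerator, of
    valuation 0, to have valuation at least 8; once the denominator is odd, the parity of the
    numerator decides the class. *)
Lemma loc_rat_residue (a : rat) : loc (a%:A : L) -> val_ge (a%:A : L) 1 \/ val_ge (a%:A - 1 : L) 1.
Proof.
move=> /loc_val_ge0; rewrite alg_ratE => Ra.
have [d_odd|d_even] := boolP (odd `|denq a|%N); last first.
  have n_odd : odd `|numq a|%N.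
    have := coprime_num_den a; apply: contraTT => n_even; apply/negP => cop.
    have : (2 %| gcdn `|numq a| `|denq a|)%N by rewrite dvdn_gcd !dvdn2 n_even d_even.
    by rewrite (eqP cop).
  have Vn := val_eq_odd n_odd.
  have := val_ge_mul Ra (val_ge_even d_even).
  rewrite divfK; last by have [k /val_eq_neq0] := val_eq_int (denq_neq0 a).
  by move/(val_ge_eq_le Vn).
have Vd := val_eq_odd d_odd; have Rd := val_eq_ge (val_eq_inv Vd).
have d0 := val_eq_neq0 Vd.
have [n_odd|n_even] := boolP (odd `|numq a|%N); last first.
  left; have := val_ge_mul (val_ge_even n_even) Rd; exact: val_ge_le.
right; have -> : (numq a)%:~R / (denq a)%:~R - 1 = (numq a - denq a)%:~R / (denq a)%:~R :> L.
  by rewrite rmorphB /=; field.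
have nd_even : ~~ odd `|(numq a - denq a)%R|%N by lia.
have := val_ge_mul (val_ge_even nd_even) Rd; exact: val_ge_le.
Qed.

(** * Valuations in terms of a uniformizer *)

Section TotallyRamified.
Variable pi : L.
Hypothesis val_pi : val_eq pi 1.
Hypothesis dimL : (\dim {:L} <= 8)%N.

Lemma val_eq_pi i : val_eq (pi ^+ i) i%:Z.
Proof. by have := val_eq_exp i val_pi; rewrite mul1r. Qed.

Lemma scale_algE (a : rat) (x : L) : a *: x = a%:A * x.
Proof. by rewrite -scalerAl mul1r. Qed.

Lemma val_eq_term (a : rat) i : a != 0 -> exists k : int, val_eq (a *: pi ^+ i) (8 * k + i%:Z).
Proof.
move=> /val_eq_rat[k Va]; exists k; rewrite scale_algE.
exact: (val_eq_mul Va (val_eq_pi i)).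
Qed.

(* The valuations of the nonzero terms are distinct modulo 8. *)
Lemma val_eq_sum (a : nat -> rat) m : (m <= 8)%N ->
  (forall i, (i < m)%N -> a i = 0) \/
  exists2 n, val_eq (\sum_(i < m) a i *: pi ^+ i) n &
    (exists k : int, 8 * k <= n < 8 * k + m%:Z) /\
    forall i, (i < m)%N -> val_ge (a i *: pi ^+ i) n.
Proof.
elim: m => [|m IHm] lt_m8; first by left.
rewrite big_ord_recr /=; have [am0|am0] := eqVneq (a m) 0.
  rewrite am0 scale0r addr0.
  have [a0|[n Vn [[k kn] Rn]]] := IHm (ltnW lt_m8); [left=> i|right; exists n => //].
    by rewrite ltnS leq_eqVlt => /predU1P[->|/a0].
  split; first by exists k; lia.
  move=> i; rewrite ltnS leq_eqVlt => /predU1P[->|/Rn //].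
  by rewrite am0 scale0r; apply: val_ge_zero.
right; have [l Vm] := val_eq_term m am0.
have [a0|[n Vn [[k kn] Rn]]] := IHm (ltnW lt_m8).
  rewrite big1 ?add0r => [|i _]; last by rewrite a0 ?scale0r.
  exists (8 * l + m%:Z) => //; split; first by exists l; lia.
  move=> i; rewrite ltnS leq_eqVlt => /predU1P[->|/a0 ->]; first exact: val_eq_ge.
  by rewrite scale0r; apply: val_ge_zero.
have [lt_nl|le_ln] := ltP n (8 * l + m%:Z).
  exists n; first exact: val_eq_addl lt_nl Vn (val_eq_ge Vm).
  split; first by exists k; lia.
  move=> i; rewrite ltnS leq_eqVlt => /predU1P[->|/Rn //].
  by apply: (@val_ge_le _ (8 * l + m%:Z)); [lia | apply: val_eq_ge].
have lt_ln : 8 * l + m%:Z < n by lia.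
exists (8 * l + m%:Z); first exact: val_eq_addr lt_ln Vm (val_eq_ge Vn).
split; first by exists l; lia.
move=> i; rewrite ltnS leq_eqVlt => /predU1P[->|/Rn]; first exact: val_eq_ge.
by apply: val_ge_le; lia.
Qed.

Lemma pi_free : free [tuple pi ^+ i | i < 8].
Proof.
apply/freeP => k sum0 i.
(* The coefficients are extended by 0 to all natural numbers, the form that [val_eq_sum] takes. *)
pose a j := if insub j is Some i then k i else 0.
have aE (j : 'I_8) : a j = k j by rewrite /a valK.
have [|a0|[n Vn _]] := @val_eq_sum a 8; first by [].
  by rewrite -aE a0.
case/eqP: (val_eq_neq0 Vn); rewrite -[RHS]sum0; apply: eq_bigr => j _.
by rewrite aE -tnth_nth tnth_mktuple.
Qed.

Lemma pi_basis : basis_of {:L} [tuple pi ^+ i | i < 8].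
Proof. by rewrite basisEfree pi_free subvf size_tuple. Qed.

Lemma dim_eq8 : \dim {:L} = 8.
Proof. exact: size_basis pi_basis. Qed.

Lemma pi_expansion (z : L) : exists a : nat -> rat, z = \sum_(i < 8) a i *: pi ^+ i.
Proof.
exists (fun j => if insub j is Some i then coord [tuple pi ^+ i | i < 8] i z else 0).
rewrite [LHS](coord_basis pi_basis (memvf z)); apply: eq_bigr => j _.
by rewrite valK -tnth_nth tnth_mktuple.
Qed.

Lemma val_eq_exists (z : L) : z != 0 -> exists n, val_eq z n.
Proof.
have [a ->] := pi_expansion z.
have [|a0|[n Vn _]] := @val_eq_sum a 8; [by [] | | by exists n].
by rewrite big1 ?eqxx // => i _; rewrite a0 ?scale0r.
Qed.

(** No cancellation occurs between the terms, so each nonzero term has valuation 8 k + i >= 0, where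
    8 k is the valuation of its coefficient. As i < 8, this forces k >= 0. *)
Lemma loc_expansion (z : L) : loc z ->
  exists2 a : nat -> rat, z = \sum_(i < 8) a i *: pi ^+ i & forall i, (i < 8)%N -> loc (a i)%:A.
Proof.
have [a ->] := pi_expansion z => Rz; exists a => // i lt_i8.
have [|a0|[n Vn [_ Rn]]] := @val_eq_sum a 8; first by [].
  by rewrite a0 // scale0r; apply: (loc_nat 0).
have [->|ai0] := eqVneq (a i) 0; first by rewrite scale0r; apply: (loc_nat 0).
have [k Vk] := val_eq_rat ai0.
have n_ge0 := val_ge_eq_le Vn (loc_val_ge0 Rz).
have le_n : n <= 8 * k + i%:Z.
  apply: (val_ge_eq_le _ (Rn i lt_i8)); rewrite scale_algE.
  exact: (val_eq_mul Vk (val_eq_pi i)).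
by apply: val_ge0_loc; apply: (val_ge_le _ (val_eq_ge Vk)); lia.
Qed.

(** The residue field of L at B is F_2 as well: all terms of the expansion except the constant one
    have positive valuation, and the constant term is rational. *)
Lemma loc_residue (z : L) : loc z -> val_ge z 1 \/ val_ge (z - 1) 1.
Proof.
move=> /loc_expansion[a -> Ra].
have Rtail : val_ge (\sum_(i < 7) a i.+1 *: pi ^+ i.+1) 1.
  elim/big_ind: _ => [|x y|i _]; [exact: val_ge_zero | exact: val_ge_add |].
  rewrite scale_algE; apply: val_ge_loc; first by apply: Ra; case: i.
  by apply: (val_ge_le _ (val_eq_ge (val_eq_pi _))); lia.
rewrite big_ord_recl /= expr0.
have [|R0|R1] := @loc_rat_residue (a 0%N); first exact: Ra.
  by left; apply: val_ge_add.
by right; rewrite addrAC; apply: val_ge_add.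
Qed.

(** Were the valuation of z not positive, z^-1 = p / q would lie in the localization, and then q = p
    z would lie in B. *)
Lemma B_val_ge z : B z -> val_ge z 1.
Proof.
move=> Bz; have [->|z0] := eqVneq z 0; first exact: val_ge_zero.
have [n Vn] := val_eq_exists z0; have [n_gt0|n_le0] := ltP 0 n.
  by apply: (val_ge_le _ (val_eq_ge Vn)); lia.
have [p [q [OLp OLq nBq Dz]]] : loc z^-1.
  by apply: val_ge0_loc; apply: (val_ge_le _ (val_eq_ge (val_eq_inv Vn))); lia.
have q0 := nB_neq0 nBq; case: nBq.
have -> : q = p * z by rewrite -[p](divfK q0) -Dz mulrAC mulVf ?mul1r.
exact: BM.
Qed.

Lemma idealpow_val n z : idealpow B n z -> OL z /\ val_ge z n%:Z.
Proof.
elim=> {n z} [z OLz|n|n x y _ [OLx Rx] _ [OLy Ry]|n a b Ba _ [OLb Rb]].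
- by split=> //; apply/loc_val_ge0/loc_OL.
- by split; [apply: (OL_nat 0) | apply: val_ge_zero].
- by split; [apply: OL_add | apply: val_ge_add].
split; first exact/OL_mul/OLb/B_OL.
by rewrite intS; apply: val_ge_mul => //; apply: B_val_ge.
Qed.

(** Clearing denominators in z / pi^(n+1) gives some w outside B with w z in B^(n+1). As the residue
    field is F_2, 1 - w lies in B; by induction z is in B^n, so both terms of z = w z + (1 - w) z
    lie in B^(n+1). *)
Lemma val_idealpow n z : OL z -> val_ge z n%:Z -> idealpow B n z.
Proof.
elim: n => [|n IHn] OLz Rz; first exact: idealpow0.
have BnZ : idealpow B n z by apply: IHn => //; apply: (val_ge_le _ Rz); lia.
have [p [q [OLp OLq nBq Dpi]]] : loc pi.
  by apply: val_ge0_loc; apply: (val_ge_le _ (val_eq_ge val_pi)).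
have Bp : B p.
  apply: val_ge_B => //; rewrite -[p](divfK (nB_neq0 nBq)) -Dpi mulrC.
  by apply: val_ge_loc; [apply: loc_OL | apply: val_eq_ge].
have [r1 [r2 [OLr1 OLr2 nBr2 Dr]]] : loc (z / pi ^+ n.+1).
  apply: val_ge0_loc; rewrite -[0](subrr (n.+1%:Z)).
  by apply: val_ge_mul => //; apply: (val_eq_ge (val_eq_inv (val_eq_pi _))).
have pow_p m r : OL r -> idealpow B m (p ^+ m * r).
  move=> OLr; elim: m => [|m IHm]; first by rewrite mul1r; apply: idealpow0.
  by rewrite exprS -mulrA; apply: idealpowM.
pose w := q ^+ n.+1 * r2.
have OLw : OL w by apply: OL_mul => //; apply: OL_exp.
have Bwz : idealpow B n.+1 (w * z).
  have pi0 : pi ^+ n.+1 != 0 := val_eq_neq0 (val_eq_pi _).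
  have -> : w * z = p ^+ n.+1 * r1; last exact: pow_p.
  rewrite -[z](divfK pi0) Dr /w Dpi expr_div_n.
  by field; rewrite (nB_neq0 nBr2) nB_neq0 //; apply: nB_exp.
have nBw : ~ B w by apply: nB_mul => //; [apply: OL_exp | apply: nB_exp].
have Bw1 : B (1 - w).
  apply: val_ge_B; first by apply: OL_add; [apply: (OL_nat 1) | apply: OL_opp].
  have [Rw|Rw1] := loc_residue (loc_OL OLw); first by case: nBw; apply: val_ge_B.
  by rewrite -opprB; apply: val_ge_opp.
have -> : z = w * z + (1 - w) * z by ring.
by apply: idealpowD => //; apply: idealpowM.
Qed.

Implicit Type g : gal_of {:L}.

Lemma OL_gal g x : OL x -> OL (g x).
Proof.
case=> p [p_monic px0]; exists p; split=> //.
have := rmorph_root g px0; rewrite -map_poly_comp.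
by rewrite (eq_map_poly (g := intr)) // => z /=; rewrite rmorph_int.
Qed.

Hypothesis gal_pi : forall g, g \in 'Gal({:L} / 1%VS)%g -> val_ge (g pi - pi) 1.

Lemma val_gal_pi g : g \in 'Gal({:L} / 1%VS)%g -> val_ge (g pi) 1.
Proof.
by move=> /gal_pi Rg; rewrite -[g pi](subrK pi); apply: val_ge_add (val_eq_ge val_pi).
Qed.

(** The coefficients of z on the powers of pi are rational, hence fixed by g, and lie in the
    localization; each g(pi)^i - pi^i is a multiple of g(pi) - pi. *)
Lemma val_gal_sub g z n : g \in 'Gal({:L} / 1%VS)%g ->
  val_ge (g pi - pi) n -> loc z -> val_ge (g z - z) n.
Proof.
move=> galg Rg /loc_expansion[a -> Ra]; rewrite rmorph_sum -sumrB.
have loc_pi : loc pi by apply: val_ge0_loc; apply: (val_ge_le _ (val_eq_ge val_pi)).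
have loc_gpi : loc (g pi) by apply: val_ge0_loc; apply: (val_ge_le _ (val_gal_pi galg)).
elim/big_ind: _ => [|x y|i _]; [exact: val_ge_zero | exact: val_ge_add |].
rewrite /= linearZ /= -scalerBr scale_algE; apply: val_ge_loc; first exact: Ra.
rewrite rmorphXn; elim: {i}(i : nat) => [|i IHi].
  by rewrite subrr; apply: val_ge_zero.
have -> : g pi ^+ i.+1 - pi ^+ i.+1 = g pi ^+ i * (g pi - pi) + pi * (g pi ^+ i - pi ^+ i).
  by rewrite !exprSr; ring.
by apply: val_ge_add; apply: val_ge_loc => //; apply: loc_exp.
Qed.

(** The conditions on all algebraic integers, and on stability of B, reduce to one condition on the
    uniformizer, through the equivalence of B^n with valuation at least n on O_L. *)
Lemma ram_groupE g i : (g \in ram_group B i) =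
  (g \in 'Gal({:L} / 1%VS)%g) && `[< val_ge (g pi - pi) i.+1%:Z >].
Proof.
rewrite inE; case galg: (g \in _) => //=; apply/asboolP/asboolP => [[_ Rg]|Rg].
  have [p [q [OLp OLq nBq Dpi]]] : loc pi.
    by apply: val_ge0_loc; apply: (val_ge_le _ (val_eq_ge val_pi)).
  have q0 := nB_neq0 nBq.
  have gq0 : g q != 0 by rewrite fmorph_eq0.
  (* The element pi is only known to be a fraction p / q of algebraic integers, so the hypothesis on
     g is applied to p and to q and combined by the quotient rule. *)
  have -> : g pi - pi = ((g p - p) * q - p * (g q - q)) / (q * g q).
    by rewrite Dpi fmorph_div; field; rewrite ?q0 ?gq0.
  have Rdp := (idealpow_val (Rg p OLp)).2; have Rdq := (idealpow_val (Rg q OLq)).2.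
  have loc_qV : loc q^-1.
    by exists 1, q; split=> //; [apply: (OL_nat 1) | rewrite mul1r].
  have loc_gqV : loc (g q)^-1.
    exists 1, (g q); split; [exact: (OL_nat 1) | exact: OL_gal | | by rewrite mul1r].
    move=> Bgq; apply: nBq; rewrite -[q](subKr (g q)); apply/BD/BN => //.
    apply: val_ge_B; first by apply/OL_add/OL_opp => //; apply: OL_gal.
    by apply: (val_ge_le _ Rdq); lia.
  rewrite mulrC invfM; apply: val_ge_loc; first exact: loc_mul.
  apply: val_ge_sub; first by rewrite mulrC; apply: val_ge_loc => //; apply: loc_OL.
  by apply: val_ge_loc => //; apply: loc_OL.
(* By [gal_pi] every h moves x by an element of B, so h maps B into B; using this for g and for its
   inverse gives g(B) = B. *)
have gB h x : h \in 'Gal({:L} / 1%VS)%g -> B x -> B (h x).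
  move=> galh Bx; rewrite -[h x](subrK x); apply: BD => //.
  apply: val_ge_B; first by apply: OL_add; [apply/OL_gal/B_OL | apply/OL_opp/B_OL].
  by apply: (val_gal_sub galh (gal_pi galh)); apply/loc_OL/B_OL.
split=> [y|x OLx].
  split=> [By|[x [Bx <-]]]; last exact: gB.
  exists (g^-1%g y); split; first by apply: gB; rewrite ?groupV.
  by rewrite -galM ?memvf // mulVg gal_id.
apply: val_idealpow; first by apply/OL_add/OL_opp => //; apply: OL_gal.
by apply: val_gal_sub => //; apply: loc_OL.
Qed.

End TotallyRamified.

(** * Displacements of conjugates *)

Lemma val_ge_two n x : val_ge x n -> val_ge (2 * x) (8 + n).
Proof. exact: val_ge_mul (val_eq_ge val_eq2). Qed.

Lemma val_eq_two n x : val_eq x n -> val_eq (2 * x) (8 + n).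
Proof. exact: val_eq_mul val_eq2. Qed.

(** Since n < m, y has the same valuation as x, and the difference is - c (y - x) / (x y). It serves
    for a uniformizer of the form 2 / x. The separate [j] lets the result be given as a numeral. *)
Lemma val_eq_inv_diff (c x y : L) k n m j :
  val_eq c k -> val_eq x n -> n < m -> val_eq (y - x) m -> j = k + m - n - n ->
  val_eq (c / y - c / x) j.
Proof.
move=> Vc Vx lt_nm Vd ->.
have Vy : val_eq y n by rewrite -[y](subrKC x); apply: val_eq_addl lt_nm Vx (val_eq_ge Vd).
have [x0 y0] := (val_eq_neq0 Vx, val_eq_neq0 Vy).
have -> : c / y - c / x = - (c * (y - x) / x / y) by field; rewrite x0 y0.
by apply: val_eq_opp; do 2!apply: val_eq_div => //; apply: val_eq_mul.
Qed.

(** With d = y - x, one has y^3 - x^3 = d (3 x^2 + 3 x d + d^2); as 3 is a unit and d has larger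
    valuation than x, the term 3 x^2 dominates. It serves for a uniformizer of the form x^3 / 2. *)
Lemma val_eq_cube_diff (c x y : L) k n m j :
  val_eq c k -> val_eq x n -> n < m -> val_eq (y - x) m -> j = m + n + n - k ->
  val_eq (y ^+ 3 / c - x ^+ 3 / c) j.
Proof.
move=> Vc Vx lt_nm Vd ->; have c0 := val_eq_neq0 Vc.
have -> : y ^+ 3 / c - x ^+ 3 / c
    = (y - x) * (3 * (x * x) + (y - x) * (3 * x + (y - x))) / c by field.
apply: val_eq_div => //; rewrite -addrA; apply: val_eq_mul => //.
have V3 : val_eq (3 : L) 0 by apply: (@val_eq_odd 3).
have Rd := val_eq_ge Vd.
apply: (@val_eq_addl _ _ _ (m + n)); first by lia.
  by rewrite -[n + n]add0r; apply/val_eq_mul/val_eq_mul.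
apply: val_ge_mul => //; apply: val_ge_add; last by apply: val_ge_le Rd; lia.
by rewrite -[n]add0r; apply: val_ge_mul (val_eq_ge V3) (val_eq_ge Vx).
Qed.

(** The triples label the eight elements of the dihedral group acting on the square with vertices a,
    b, -a, -b: w exchanges the two diagonals, and e1, e2 are signs. The central element is (false,
    true, true); those of order 4 have w true and e1 different from e2. *)
Definition dihedral_act (g : L -> L) (s a b : L) (t : bool * bool * bool) : Prop :=
  let: (w, e1, e2) := t in
  [/\ g s = (-1) ^+ w * s, g a = (-1) ^+ e1 * (if w then b else a)
    & g b = (-1) ^+ e2 * (if w then a else b)].

(** * A uniformizer when c = 1 mod 4 *)

Section OddConstant.
Variables s a b q : L.
Hypotheses (Rq : val_ge q 0) (s2 : s ^+ 2 = - (1 + 4 * q)).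
Hypotheses (a2 : a ^+ 2 = s ^+ 2 + s) (b2 : b ^+ 2 = s ^+ 2 - s).

Let V2 := val_eq2.
Let R2 := val_eq_ge val_eq2.
Let R4q : val_ge (4 * q) 16.
Proof.
have -> : 4 * q = 2 * (2 * q) by ring.
exact: val_ge_two (val_ge_two Rq).
Qed.

Let Vc : val_eq (1 + 4 * q) 0.
Proof. exact/val_eq_unit/(val_ge_le _ R4q). Qed.

Let Vo : val_eq (1 + 2 * q) 0.
Proof. by apply: val_eq_unit; apply: (val_ge_le _ (val_ge_two Rq)). Qed.

Let Vs : val_eq s 0.
Proof. by apply: (@val_eq_rootn _ _ 2) => //; rewrite s2; apply: val_eq_opp. Qed.

(** The product s^2 - 1 = - 2 (1 + 2 q) has valuation 8, and the two factors differ by 2. *)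
Let Vs1 : val_eq (s + 1) 4 /\ val_eq (s - 1) 4.
Proof.
have Vprod : val_eq ((s + 1) * (s - 1)) (4 + 4).
  have -> : (s + 1) * (s - 1) = - (2 * (1 + 2 * q)) by ring: s2.
  exact/val_eq_opp/(val_eq_two Vo).
split; apply: val_eq_factor.
- exact: Vprod.
- have -> : s + 1 - (s - 1) = 2 by ring.
  exact: val_ge_le R2.
- by rewrite mulrC; apply: Vprod.
have -> : s - 1 - (s + 1) = - 2 by ring.
by apply: val_ge_opp; apply: val_ge_le R2.
Qed.

Let Va : val_eq a 2.
Proof.
apply: (@val_eq_rootn _ _ 2) => //; have -> : a ^+ 2 = s * (s + 1) by ring: a2.
exact: (val_eq_mul Vs (proj1 Vs1)).
Qed.

Let Vb : val_eq b 2.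
Proof.
apply: (@val_eq_rootn _ _ 2) => //; have -> : b ^+ 2 = s * (s - 1) by ring: b2.
exact: (val_eq_mul Vs (proj2 Vs1)).
Qed.

Let Vab : val_eq (a * b) 4.
Proof. exact: (val_eq_mul Va Vb). Qed.

Let Vs2 : val_eq (s ^+ 2) 0.
Proof. exact: (val_eq_exp 2 Vs). Qed.

Let Vamb : val_eq (a - b) 4.
Proof.
apply: (@val_eq_rootn _ _ 2) => //.
have -> : (a - b) ^+ 2 = 2 * (s ^+ 2 - a * b) by ring: a2 b2.
apply: (@val_eq_two 0); apply: (@val_eq_addl _ _ _ 4) => //.
exact/val_ge_opp/val_eq_ge.
Qed.

(** As s - s^2 = - b^2, this is the difference of a - b and b^2, both of valuation 4. The companion
    factor a - b + b^2 differs from it by 2 b^2, of valuation 12. *)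
Let x := a - b + s - s ^+ 2.

(** Up to the factor -2, this is the product of x and its companion a - b + b^2. Its own valuation
    comes from the product with the element obtained by changing the sign of a b. *)
Let W := (1 + 4 * q) * (1 + 2 * q + s) + a * b.

Let VW : val_eq W 6.
Proof.
have Vcs : val_eq ((1 + 4 * q) * s - 1) 4.
  have -> : (1 + 4 * q) * s - 1 = (s - 1) + s * (4 * q) by ring.
  apply: (@val_eq_addl _ _ _ 16 _ (proj2 Vs1)) => //.
  exact: (val_ge_mul (val_eq_ge Vs) R4q).
apply: (@val_eq_factor _ ((1 + 4 * q) * (1 + 2 * q + s) - a * b)).
  have -> : W * ((1 + 4 * q) * (1 + 2 * q + s) - a * b)
      = (1 + 4 * q) * (2 * ((1 + 2 * q) * ((1 + 4 * q) * s - 1))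
                       + (1 + 4 * q) * (q * (4 * q))).
    by rewrite /W; ring: s2 a2 b2.
  apply: (@val_eq_mul _ _ 0 12 Vc); apply: (@val_eq_addl _ _ _ 16) => //.
    exact: (val_eq_two (val_eq_mul Vo Vcs)).
  exact: (val_ge_mul (val_eq_ge Vc) (val_ge_mul Rq R4q)).
have -> : W - ((1 + 4 * q) * (1 + 2 * q + s) - a * b) = 2 * (a * b) by rewrite /W; ring.
exact: (val_ge_le _ (val_eq_ge (val_eq_two Vab))).
Qed.

Let Vx : val_eq x 7.
Proof.
apply: (@val_eq_factor _ (a - b - s + s ^+ 2)).
  have -> : x * (a - b - s + s ^+ 2) = - (2 * W) by rewrite /x /W; ring: s2 a2 b2.
  exact/val_eq_opp/(val_eq_two VW).
have -> : x - (a - b - s + s ^+ 2) = - (2 * b ^+ 2) by rewrite /x; ring: b2.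
apply: val_ge_opp; apply: (val_ge_le _ (val_eq_ge (val_eq_two (val_eq_exp 2 Vb)))).
by lia.
Qed.

Lemma odd_uniformizer : exists2 pi : L, val_eq pi 1 &
  forall (g : {rmorphism L -> L}) w e1 e2, dihedral_act g s a b (w, e1, e2) ->
    [|| w, e1 | e2] ->
  val_eq (g pi - pi) (if w then 2 else if e1 && e2 then 6 else 4).
Proof.
exists (2 / x); first exact: (val_eq_div V2 Vx).
move=> g w e1 e2 [gs ga gb] t_neq0; rewrite fmorph_div rmorph_nat.
have -> : g x = g a - g b + g s - (g s) ^+ 2.
  by rewrite /x !(rmorphB, rmorphD) rmorphXn.
rewrite ga gb gs.
have V2a := val_eq_two Va; have V2b := val_eq_two Vb; have V2s := val_eq_two Vs.
(* The displacement of x has valuation 8 if w holds (from 2 s), 12 for the central element (from 2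
   (a - b)) and 10 for the remaining two; [val_eq_inv_diff] subtracts 6. *)
case: w e1 e2 t_neq0 {gs ga gb} => [] [] [] //= _; rewrite ?expr0 ?expr1.
- apply: (@val_eq_inv_diff _ _ _ 8 7 8) => //.
  have -> : -1 * b - -1 * a + -1 * s - (-1 * s) ^+ 2 - x = - (2 * s) by rewrite /x; ring.
  exact: val_eq_opp.
- apply: (@val_eq_inv_diff _ _ _ 8 7 8) => //.
  have -> : -1 * b - 1 * a + -1 * s - (-1 * s) ^+ 2 - x = - (2 * s + 2 * a) by rewrite /x; ring.
  by apply: val_eq_opp; apply: (@val_eq_addl _ _ _ 10) => //; apply: val_eq_ge.
- apply: (@val_eq_inv_diff _ _ _ 8 7 8) => //.
  have -> : 1 * b - -1 * a + -1 * s - (-1 * s) ^+ 2 - x = - (2 * s) + 2 * b by rewrite /x; ring.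
  by apply: (@val_eq_addl _ _ _ 10) => //; [apply: val_eq_opp | apply: val_eq_ge].
- apply: (@val_eq_inv_diff _ _ _ 8 7 8) => //.
  have -> : 1 * b - 1 * a + -1 * s - (-1 * s) ^+ 2 - x = - (2 * s + 2 * (a - b)).
    by rewrite /x; ring.
  apply: val_eq_opp; apply: (@val_eq_addl _ _ _ 12) => //.
  exact: (val_eq_ge (val_eq_two Vamb)).
- apply: (@val_eq_inv_diff _ _ _ 8 7 12) => //.
  have -> : -1 * a - -1 * b + 1 * s - (1 * s) ^+ 2 - x = - (2 * (a - b)) by rewrite /x; ring.
  exact/val_eq_opp/(val_eq_two Vamb).
- apply: (@val_eq_inv_diff _ _ _ 8 7 10) => //.
  have -> : -1 * a - 1 * b + 1 * s - (1 * s) ^+ 2 - x = - (2 * a) by rewrite /x; ring.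
  exact: val_eq_opp.
apply: (@val_eq_inv_diff _ _ _ 8 7 10) => //.
by have -> : 1 * a - -1 * b + 1 * s - (1 * s) ^+ 2 - x = 2 * b by rewrite /x; ring.
Qed.

End OddConstant.

(** * A uniformizer when c = 2^(2k+1) m *)

Section EvenConstant.
(** Here s, a, b stand for the rescaled generators s', a', b', while p = 2^k and n = (-m)^k. *)
Variables s a b m n p : L.
Hypotheses (Vm : val_eq m 0) (Vn : val_eq n 0) (Rm : val_ge (m - 1) 8) (Rn : val_ge (n - 1) 8).
Hypotheses (Rp : val_ge p 8) (Dm : m = - (s ^+ 2) / 2).
Hypotheses (a2 : a ^+ 2 = s * (1 + p * s) / n) (b2 : b ^+ 2 = - (s * (1 - p * s)) / n).

Let V2 := val_eq2.
Let n0 := val_eq_neq0 Vn.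
Let t0 := two_neq0.

Let Vs : val_eq s 4.
Proof.
apply: (@val_eq_rootn _ _ 2) => //; have -> : s ^+ 2 = - (2 * m) by rewrite Dm; field.
exact/val_eq_opp/(val_eq_two Vm).
Qed.

Let s0 := val_eq_neq0 Vs.

Let s20 : - s ^+ 2 != 0.
Proof. by rewrite oppr_eq0 expf_neq0 ?s0. Qed.

Let Rps : val_ge (p * s) 12.
Proof. exact: (val_ge_mul Rp (val_eq_ge Vs)). Qed.

Let Vps1 : val_eq (1 + p * s) 0.
Proof. exact/val_eq_unit/(val_ge_le _ Rps). Qed.

Let Vps1' : val_eq (1 - p * s) 0.
Proof. exact/val_eq_unit/val_ge_opp/(val_ge_le _ Rps). Qed.

Let ps0' := val_eq_neq0 Vps1'.

Let Va : val_eq a 2.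
Proof.
apply: (@val_eq_rootn _ _ 2) => //; rewrite a2.
exact: (val_eq_div (val_eq_mul Vs Vps1) Vn).
Qed.

Let Vb : val_eq b 2.
Proof.
apply: (@val_eq_rootn _ _ 2) => //; rewrite b2.
exact: (val_eq_div (val_eq_opp (val_eq_mul Vs Vps1')) Vn).
Qed.

Let a0 := val_eq_neq0 Va.
Let b0 := val_eq_neq0 Vb.

Let r := a / b.

Let Vr : val_eq r 0.
Proof. exact: (val_eq_div Va Vb). Qed.

(** The quotient r is nearly a square root of -1, and D measures the error. Hence r - 1 and r + 1
    have valuation 4, half that of 2. *)
Let D := r ^+ 2 + 1.

Let RD : val_ge D 20.
Proof.
have -> : D = - (2 * (p * s) / (1 - p * s)).
  rewrite /D /r expr_div_n a2 b2; field.
  by rewrite ?n0 ?s0 ?oppr_eq0 ?mulf_neq0 // ?ps0'.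
apply: val_ge_opp.
exact: (val_ge_mul (val_ge_two Rps) (val_eq_ge (val_eq_inv Vps1'))).
Qed.

Let Vrm : val_eq (r - 1) 4.
Proof.
apply: (@val_eq_rootn _ _ 2) => //; have -> : (r - 1) ^+ 2 = - (2 * r) + D by rewrite /D; ring.
by apply: (@val_eq_addl _ _ _ 20) => //; apply/val_eq_opp/(val_eq_two Vr).
Qed.

Let Vrp : val_eq (r + 1) 4.
Proof.
apply: (@val_eq_rootn _ _ 2) => //; have -> : (r + 1) ^+ 2 = 2 * r + D by rewrite /D; ring.
by apply: (@val_eq_addl _ _ _ 20) => //; apply: (val_eq_two Vr).
Qed.

(** The quotient (r - 1) / s is a unit, so subtracting 1 raises the valuation; the gain is read off
    from h^2, whose leading term is (r + 1) / m. *)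
Let h := (r - 1) / s - 1.

Let R2rs : val_ge (2 * ((r - 1) / s)) 8.
Proof. exact: (val_ge_two (val_eq_ge (val_eq_div Vrm Vs))). Qed.

Let RD2m : val_ge (D / (2 * m)) 8.
Proof.
apply: (@val_ge_le _ 12) => //.
exact: (val_ge_mul RD (val_eq_ge (val_eq_inv (val_eq_two Vm)))).
Qed.

Let Vh : val_eq h 2.
Proof.
apply: (@val_eq_rootn _ _ 2) => //.
have -> : h ^+ 2 = (r + 1 + (m - 1)) / m + (- (D / (2 * m)) - 2 * ((r - 1) / s)).
  by rewrite /h /D Dm; field; rewrite s0 t0 s20.
apply: (@val_eq_addl _ _ _ 8) => //; last exact: (val_ge_sub (val_ge_opp RD2m) R2rs).
by apply: (@val_eq_div _ _ 4 0) => //; apply: (@val_eq_addl _ _ _ 8).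
Qed.

Let x := a - (r - 1) / s + 1.

Let Vx : val_eq x 3.
Proof.
apply: (@val_eq_factor _ (a + h)); last first.
  have -> : x - (a + h) = - (2 * h) by rewrite /x /h; ring.
  by apply: val_ge_opp; apply: (val_ge_le _ (val_eq_ge (val_eq_two Vh))).
(* The product is a^2 - h^2. Its terms s / n and - s / m of valuation 4 cancel up to valuation 12
   because m and n are 1 modulo 2, which leaves - s h / m, of valuation 6. *)
have -> : x * (a + h) = - (s * h / m) + (s * (m - 1 - (n - 1)) / (n * m) + s * (p * s) / n
     - ((m - 1 + 2) / m - D / (2 * m) - 2 * ((r - 1) / s))).
  have -> : x * (a + h) = a ^+ 2 - h ^+ 2 by rewrite /x /h; ring.
  by rewrite a2 /h /D Dm; field; rewrite s0 t0 n0 s20.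
apply: (@val_eq_addl _ _ _ 8) => //.
  exact/val_eq_opp/(val_eq_div (val_eq_mul Vs Vh) Vm).
have RmV := val_eq_ge (val_eq_inv Vm); have RnV := val_eq_ge (val_eq_inv Vn).
have Rs := val_eq_ge Vs.
apply: val_ge_sub; first apply: val_ge_add.
- apply: (@val_ge_le _ 12) => //; rewrite invfM.
  exact: (val_ge_mul (val_ge_mul Rs (val_ge_sub Rm Rn)) (val_ge_mul RnV RmV)).
- apply: (@val_ge_le _ 16) => //; exact: (val_ge_mul (val_ge_mul Rs Rps) RnV).
apply: val_ge_sub => //; apply: val_ge_sub => //.
exact: (val_ge_mul (val_ge_add Rm (val_eq_ge V2)) RmV).
Qed.

Lemma even_uniformizer : exists2 pi : L, val_eq pi 1 &
  forall (g : {rmorphism L -> L}) w e1 e2, dihedral_act g s a b (w, e1, e2) ->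
    [|| w, e1 | e2] ->
  val_eq (g pi - pi) (if w then (if e1 == e2 then 2 else 4) else if e1 && e2 then 8 else 2).
Proof.
exists (x ^+ 3 / 2); first exact: (val_eq_div (val_eq_exp 3 Vx) V2).
move=> g w e1 e2 [gs ga gb] t_neq0; rewrite fmorph_div rmorph_nat rmorphXn.
have -> : g x = g a - (g a / g b - 1) / g s + 1.
  by rewrite /x /r !(rmorphB, rmorphD, fmorph_div, rmorph1).
rewrite ga gb gs.
have V2a : val_eq (2 * a) 10 := val_eq_two Va.
have V2rs : val_eq (2 * (r / s)) 4 := val_eq_two (val_eq_div Vr Vs).
have Vbma : val_eq (b - a) 6.
  have -> : b - a = - (b * (r - 1)) by rewrite /r; field.
  exact/val_eq_opp/(val_eq_mul Vb Vrm).
have Vbpa : val_eq (b + a) 6.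
  have -> : b + a = b * (r + 1) by rewrite /r; field.
  exact: (val_eq_mul Vb Vrp).
have Vrm2 : val_eq ((r - 1) ^+ 2 / r / s) 4.
  exact: (val_eq_div (val_eq_div (val_eq_exp 2 Vrm) Vr) Vs).
have RrD : val_ge ((D - 2 * (r + 1)) / r / s) 8.
  apply: (@val_ge_mul _ _ 12 (- 4%:Z)); last exact: (val_eq_ge (val_eq_inv Vs)).
  apply: (@val_ge_mul _ _ 12 0); last exact: (val_eq_ge (val_eq_inv Vr)).
  by apply: val_ge_sub; [apply: val_ge_le RD | apply: (val_ge_two (val_eq_ge Vrp))].
(* The displacement of x has valuation 10 for the central element, which moves only a; 6 for the
   elements of order 4, where a moves by 6 and (r - 1) / s by at least 8 since -1/r is close to r;
   and 4 otherwise, from (r - 1) / s. [val_eq_cube_diff] subtracts 2. *)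
case: w e1 e2 t_neq0 {gs ga gb} => [] [] [] //= _; rewrite ?expr0 ?expr1.
- apply: (@val_eq_cube_diff _ _ _ 8 3 4) => //.
  have -> : -1 * b - (-1 * b / (-1 * a) - 1) / (-1 * s) + 1 - x
      = (r - 1) ^+ 2 / r / s + - (b + a).
    by rewrite /x /r; field; rewrite s0 a0 b0 ?oppr_eq0 ?oner_eq0.
  by apply: (@val_eq_addl _ _ _ 6) => //; apply/val_ge_opp/val_eq_ge.
- apply: (@val_eq_cube_diff _ _ _ 8 3 6) => //.
  have -> : -1 * b - (-1 * b / (1 * a) - 1) / (-1 * s) + 1 - x
      = - (b + a) + (D - 2 * (r + 1)) / r / s.
    by rewrite /x /D /r; field; rewrite s0 a0 b0 ?oppr_eq0 ?oner_eq0.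
  by apply: (@val_eq_addl _ _ _ 8) => //; apply: val_eq_opp.
- apply: (@val_eq_cube_diff _ _ _ 8 3 6) => //.
  have -> : 1 * b - (1 * b / (-1 * a) - 1) / (-1 * s) + 1 - x
      = (b - a) + (D - 2 * (r + 1)) / r / s.
    by rewrite /x /D /r; field; rewrite s0 a0 b0 ?oppr_eq0 ?oner_eq0.
  exact: (@val_eq_addl _ _ _ 8).
- apply: (@val_eq_cube_diff _ _ _ 8 3 4) => //.
  have -> : 1 * b - (1 * b / (1 * a) - 1) / (-1 * s) + 1 - x
      = (r - 1) ^+ 2 / r / s + (b - a).
    by rewrite /x /r; field; rewrite s0 a0 b0 ?oppr_eq0 ?oner_eq0.
  by apply: (@val_eq_addl _ _ _ 6) => //; apply: val_eq_ge.
- apply: (@val_eq_cube_diff _ _ _ 8 3 10) => //.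
  have -> : -1 * a - (-1 * a / (-1 * b) - 1) / (1 * s) + 1 - x = - (2 * a).
    by rewrite /x /r; field; rewrite s0 b0 ?oppr_eq0 ?oner_eq0.
  exact: val_eq_opp.
- apply: (@val_eq_cube_diff _ _ _ 8 3 4) => //.
  have -> : -1 * a - (-1 * a / (1 * b) - 1) / (1 * s) + 1 - x = 2 * (r / s) - 2 * a.
    by rewrite /x /r; field; rewrite s0 b0 ?oppr_eq0 ?oner_eq0.
  by apply: (@val_eq_addl _ _ _ 10) => //; apply/val_ge_opp/val_eq_ge.
apply: (@val_eq_cube_diff _ _ _ 8 3 4) => //.
have -> : 1 * a - (1 * a / (-1 * b) - 1) / (1 * s) + 1 - x = 2 * (r / s).
  by rewrite /x /r; field; rewrite s0 b0 ?oppr_eq0 ?oner_eq0.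
exact: V2rs.
Qed.

End EvenConstant.

(** * Counting the ramification groups *)

Lemma galois_rat : galois 1%VS {:L}.
Proof.
apply/and3P; split; [exact: sub1v | | exact: normalFieldf].
apply/separableP => y _; apply: pcharf0_separable.
by apply/pcharf0P; case=> [|n]; rewrite ?eqxx // (negPf (natL_neq0 n)).
Qed.

Lemma card_bool3 (P : pred (bool * bool * bool)) :
  #|[set t | P t]| = (\sum_(w : bool) \sum_(e1 : bool) \sum_(e2 : bool) P (w, e1, e2))%N.
Proof.
rewrite cardsE -sum1_card big_mkcond /= !pair_bigA /=.
by apply: eq_bigr => -[[w e1] e2] _; rewrite unfold_in; case: (P _).
Qed.

Section RamificationNumbers.
Variables (pi s a b : L) (J : bool -> bool -> bool -> nat).
Hypotheses (val_pi : val_eq pi 1) (dimL : (\dim {:L} <= 8)%N).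
Hypothesis gal_gen : forall g g' : gal_of {:L},
  g s = g' s -> g a = g' a -> g b = g' b -> g = g'.
Hypothesis gal_act : forall g : gal_of {:L}, exists t, dihedral_act g s a b t.
Hypothesis J_gt0 : forall w e1 e2, (0 < J w e1 e2)%N.
Hypothesis J_val : forall (g : {rmorphism L -> L}) w e1 e2,
  dihedral_act g s a b (w, e1, e2) -> [|| w, e1 | e2] -> val_eq (g pi - pi) (J w e1 e2)%:Z.

(** Automorphisms are counted by their triples. The identity lies in every G_i, and a nontrivial g
    lies in G_i exactly when i < J. *)
Lemma card_ram_group i :
  #|ram_group B i| = (\sum_(w : bool) \sum_(e1 : bool) \sum_(e2 : bool)
                       (~~ [|| w, e1 | e2] || (i < J w e1 e2)))%N.
Proof.
pose P (t : bool * bool * bool) := let: (w, e1, e2) := t in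
  ~~ [|| w, e1 | e2] || (i < J w e1 e2)%N.
pose phi (g : gal_of {:L}) := sval (cid (gal_act g)).
have phiP (g : gal_of {:L}) : dihedral_act g s a b (phi g) by rewrite /phi; case: cid.
have phi_inj : injective phi.
  move=> g g' eq_phi; have := phiP g; have := phiP g'; rewrite -eq_phi.
  case: (phi g) => -[w e1] e2 [gs' ga' gb'] [gs ga gb].
  by apply: gal_gen; [rewrite gs gs' | rewrite ga ga' | rewrite gb gb'].
have phi_1 (g : gal_of {:L}) : phi g = (false, false, false) -> g = 1%g.
  move=> phig; have := phiP g; rewrite phig => -[gs ga gb].
  by apply: gal_gen; rewrite gal_id ?gs ?ga ?gb expr0 mul1r.
have ramP (g : gal_of {:L}) : val_ge (g pi - pi) i.+1%:Z <-> P (phi g).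
  have := phiP g; case phig: (phi g) => [[w e1] e2] /J_val Vg; rewrite /P.
  have [t_neq0|t_eq0] /= := boolP [|| w, e1 | e2].
    have {}Vg := Vg t_neq0; split=> [/(val_ge_eq_le Vg)|lt_iJ]; first by lia.
    by apply: (val_ge_le _ (val_eq_ge Vg)); lia.
  split=> // _; rewrite (phi_1 g) ?gal_id ?subrr; first exact: val_ge_zero.
  by move: phig t_eq0; case: w e1 e2 {Vg} => [] [] [].
have gal_pi1 (g : gal_of {:L}) : g \in 'Gal({:L} / 1%VS)%g -> val_ge (g pi - pi) 1.
  move=> _; have := phiP g; case phig: (phi g) => [[w e1] e2] /J_val Vg.
  have [t_neq0|t_eq0] /= := boolP [|| w, e1 | e2].
    by apply: (val_ge_le _ (val_eq_ge (Vg t_neq0))); have := J_gt0 w e1 e2; lia.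
  rewrite (phi_1 g) ?gal_id ?subrr; first exact: val_ge_zero.
  by move: phig t_eq0; case: w e1 e2 {Vg} => [] [] [].
(* The Galois group has order [L : Q] = 8, the number of triples, so the injection [phi] is onto. *)
have phi_onto : phi @: 'Gal({:L} / 1%VS)%g = setT.
  apply/eqP; rewrite eqEcard subsetT card_imset // cardsT !card_prod card_bool.
  by rewrite -(galois_dim galois_rat) dimv1 divn1 (dim_eq8 val_pi dimL).
transitivity #|[set t | P t]|; last exact: card_bool3.
rewrite -(card_imset _ phi_inj); apply: eq_card => t; rewrite inE.
have /imsetP[g galg ->] : t \in phi @: 'Gal({:L} / 1%VS)%g by rewrite phi_onto inE.
rewrite mem_imset // (ram_groupE val_pi dimL gal_pi1) galg /=.
by apply/asboolP/idP => /ramP.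
Qed.

End RamificationNumbers.
End Localization.

(** * The splitting field and its Galois group *)

Section SplittingField.
Variables (L : splittingFieldType rat) (c : int).
Hypothesis hL : splittingFieldFor 1%VS (map_poly (in_alg L) (fc c)) {:L}.

Lemma map_fc :
  map_poly (in_alg L) (fc c) = ('X^2 + (c%:~R)%:P) ^+ 2 + (c%:~R)%:P.
Proof.
rewrite /fc rmorphD rmorphXn rmorphD rmorphXn /= map_polyX !map_polyC /=.
by rewrite -[_%:A]/(in_alg L _) rmorph_int.
Qed.

(** Any root a gives s = a^2 + c with s^2 = -c. The polynomial then factors as (X^2 + c + s) (X^2 +
    c - s); b is a root of the first factor, and all roots are a, -a, b, -b. *)
Lemma splitting_generators : exists a b s : L,
  [/\ s ^+ 2 = - c%:~R, a ^+ 2 = s - c%:~R, b ^+ 2 = - s - c%:~R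
    & <<<<<<1; s>>; a>>; b>>%VS = {:L}%VS].
Proof.
case: hL => rs; rewrite map_fc; set C : L := c%:~R => Drs genL.
have sz_quad d : size ('X^2 + d%:P : {poly L}) = 3 by rewrite size_XnaddC.
have [a rs_a] : exists a, a \in rs.
  case: rs Drs {genL} => [|a rs _]; last by exists a; rewrite mem_head.
  rewrite big_nil => /eqp_size; rewrite size_poly1 => size_fc.
  have : (('X^2 + C%:P) ^+ 2 + C%:P)`_4 = 0 by rewrite nth_default // size_fc.
  have -> : ('X^2 + C%:P) ^+ 2 + C%:P = 'X^4 + (C + C)%:P * 'X^2 + (C ^+ 2 + C)%:P.
    by rewrite !polyCD polyC_exp; ring.
  by rewrite !coefE /= mulr0 !addr0 => /eqP; rewrite oner_eq0.
have root_rs z : z \in rs -> (z ^+ 2 + C) ^+ 2 + C = 0.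
  by rewrite -root_prod_XsubC -(eqp_root Drs) /root !hornerE => /eqP.
pose s := a ^+ 2 + C.
have s2 : s ^+ 2 = - C by apply/eqP; rewrite -addr_eq0; apply/eqP/root_rs.
have [b b2] : exists b, b ^+ 2 = - s - C.
  (* A divisor of a product of linear factors is associate to a subproduct, which is nonempty here
     by degree. *)
  have: 'X^2 + (C + s)%:P %| \prod_(z <- rs) ('X - z%:P).
    have SP : s%:P ^+ 2 = - C%:P by rewrite -rmorphXn s2 rmorphN.
    rewrite -(eqp_dvdr _ Drs).
    have -> : ('X^2 + C%:P) ^+ 2 + C%:P = ('X^2 + (C + s)%:P) * ('X^2 + (C - s)%:P).
      by rewrite polyCD polyCB; ring: SP.
    exact: dvdp_mulIl.
  case/dvdp_prod_XsubC=> m; case: (mask m rs) => [|b r].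
    by move/eqp_size; rewrite big_nil size_poly1 sz_quad.
  move/eqp_root => /(_ b); rewrite root_prod_XsubC mem_head.
  rewrite /root hornerD hornerXn hornerC => /eqP b0.
  by exists b; apply/eqP; rewrite -subr_eq0 -b0 /s; apply/eqP; ring.
exists a, b, s; split=> //; first by rewrite /s; ring.
apply/eqP; rewrite eqEsubv subvf -genL; apply/Fadjoin_seqP.
split=> [|z /root_rs z0].
  by do 2!apply: subv_trans (subv_adjoin _ _); apply: subv_adjoin.
have memb : b \in <<<<<<1; s>>; a>>; b>>%VS by apply: memv_adjoin.
have mema : a \in <<<<<<1; s>>; a>>; b>>%VS.
  by apply: subvP (subv_adjoin _ _) _ _; apply: memv_adjoin.
have /eqP : (z ^+ 2 + C) ^+ 2 = s ^+ 2 by rewrite s2; apply/eqP; rewrite -addr_eq0; apply/eqP.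
rewrite eqf_sqr => /orP[] /eqP Dz.
  have /eqP : z ^+ 2 = a ^+ 2 by rewrite -[z ^+ 2](addrK C) Dz addrK.
  by rewrite eqf_sqr => /orP[] /eqP ->; rewrite ?rpredN.
have /eqP : z ^+ 2 = b ^+ 2 by rewrite -[z ^+ 2](addrK C) Dz b2.
by rewrite eqf_sqr => /orP[] /eqP ->; rewrite ?rpredN.
Qed.

Lemma dim_adjoin_sqrt (K : {subfield L}) x :
  x ^+ 2 \in K -> (\dim <<K; x>> <= 2 * \dim K)%N.
Proof.
move=> Kx2; rewrite dim_Fadjoin leq_mul2r; apply/orP; right.
rewrite -ltnS -size_minPoly -(size_XnsubC (x ^+ 2) (isT : 0 < 2)%N).
apply: dvdp_leq; first by rewrite -size_poly_gt0 size_XnsubC.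
apply: minPoly_dvdp; last by rewrite /root !hornerE subrr.
by rewrite rpredB ?rpredX ?polyOverX ?polyOverC.
Qed.

Lemma dim_le8 (a b s : L) : s ^+ 2 = - c%:~R -> a ^+ 2 = s - c%:~R -> b ^+ 2 = - s - c%:~R ->
  <<<<<<1; s>>; a>>; b>>%VS = {:L}%VS -> (\dim {:L} <= 8)%N.
Proof.
move=> s2 a2 b2 <-; have mems : s \in <<1; s>>%VS := memv_adjoin _ _.
apply: leq_trans (dim_adjoin_sqrt _) _.
  apply: subvP (subv_adjoin _ _) _ _.
  by rewrite b2 rpredB ?rpredN ?rpred_int.
rewrite (leq_mul2l 2 _ 4) /=; apply: leq_trans (dim_adjoin_sqrt _) _.
  by rewrite a2 rpredB ?rpred_int.
rewrite (leq_mul2l 2 _ 2) /=; apply: leq_trans (dim_adjoin_sqrt _) _.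
  by rewrite s2 rpredN rpred_int.
by rewrite dimv1.
Qed.

Lemma eq_gal_adjoin (K : {subfield L}) x (g g' : gal_of {:L}) :
  {in K, g =1 g'} -> g x = g' x -> {in <<K; x>>%VS, g =1 g'}.
Proof.
move=> eqK eqx _ /Fadjoin_polyP[p Kp ->]; rewrite -!horner_map /= eqx.
congr (_.[_]); apply/polyP => i; rewrite !coef_map.
by apply: eqK; apply: (polyOverP Kp).
Qed.

Lemma eq_gal (a b s : L) (g g' : gal_of {:L}) : <<<<<<1; s>>; a>>; b>>%VS = {:L}%VS ->
  g s = g' s -> g a = g' a -> g b = g' b -> g = g'.
Proof.
move=> genL eqs eqa eqb; apply/eqP/gal_eqP => x _.
move: (memvf x); rewrite -genL; move: x; do 3!apply: eq_gal_adjoin => //; move=> _ /vlineP[z ->].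
by rewrite !linearZ !rmorph1.
Qed.

Lemma gal_dihedral (a b s : L) (g : {rmorphism L -> L}) :
  s ^+ 2 = - c%:~R -> a ^+ 2 = s - c%:~R -> b ^+ 2 = - s - c%:~R ->
  exists t, dihedral_act g s a b t.
Proof.
move=> s2 a2 b2.
have sqr_eq (x y : L) : x ^+ 2 = y ^+ 2 -> exists e : bool, x = (-1) ^+ e * y.
  move/eqP; rewrite eqf_sqr => /orP[/eqP ->|/eqP ->].
    by exists false; rewrite mul1r.
  by exists true; rewrite mulN1r.
have [w gs] : exists w : bool, g s = (-1) ^+ w * s.
  by apply: sqr_eq; rewrite -rmorphXn s2 rmorphN rmorph_int.
have [e1 ga] : exists e1 : bool, g a = (-1) ^+ e1 * (if w then b else a).
  apply: sqr_eq; rewrite -rmorphXn a2 rmorphB rmorph_int gs.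
  by case: (w); rewrite ?a2 ?b2 ?mul1r ?mulN1r.
have [e2 gb] : exists e2 : bool, g b = (-1) ^+ e2 * (if w then a else b).
  apply: sqr_eq; rewrite -rmorphXn b2 rmorphB rmorphN rmorph_int gs.
  by case: (w); rewrite ?a2 ?b2 ?mul1r ?mulN1r ?opprK.
by exists (w, e1, e2).
Qed.

End SplittingField.

(** An automorphism negates s exactly when it exchanges a and b up to sign. Dividing a by a power of
    s' and b by the same power of -s' therefore keeps the triple. *)
Lemma dihedral_act_rescale (L : splittingFieldType rat) (g : {rmorphism L -> L}) (s a b : L) t k :
  dihedral_act g s a b t ->
  dihedral_act g (s / 2 ^+ k) (a / (s / 2 ^+ k) ^+ k) (b / (- (s / 2 ^+ k)) ^+ k) t.
Proof.
case: t => -[w e1] e2 [gs ga gb]; set s1 := s / 2 ^+ k.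
have gs1 : g s1 = (-1) ^+ w * s1 by rewrite fmorph_div rmorphXn rmorph_nat gs mulrA.
split=> //; rewrite fmorph_div rmorphXn ?rmorphN gs1 ?ga ?gb -mulrA; congr (_ * _);
  by case: (w); rewrite ?mulN1r ?mul1r ?opprK.
Qed.

Lemma eq_rmorph_div (L : fieldType) (g g' : {rmorphism L -> L}) x u :
  u != 0 -> g u = g' u -> g (x / u) = g' (x / u) -> g x = g' x.
Proof. by move=> u0 gu gx; rewrite -[x](divfK u0) rmorphM gx gu -rmorphM. Qed.

(** * Ramification groups of the splitting field in the two cases *)

Section Ramification.
Variables (c : int) (L : splittingFieldType rat).
Hypothesis hL : splittingFieldFor 1%VS (map_poly (in_alg L) (fc c)) {:L}.
Variable B : L -> Prop.
Hypothesis hB : prime_ideal_above2 B.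

Lemma card_ram_odd i : (c %% 4)%Z = 1 ->
  #|ram_group B i| = (\sum_(w : bool) \sum_(e1 : bool) \sum_(e2 : bool)
    (~~ [|| w, e1 | e2] || (i < if w then 2 else if e1 && e2 then 6 else 4)))%N.
Proof.
move=> c_mod4; have [q Dc] : exists q, c = 1 + 4 * q by exists (c %/ 4)%Z; lia.
have [a [b [s [s2 a2 b2 genL]]]] := splitting_generators hL.
have DcL : c%:~R = 1 + 4 * q%:~R :> L by rewrite Dc rmorphD rmorphM.
have s2' : s ^+ 2 = - (1 + 4 * q%:~R) by rewrite s2 DcL.
have [||pi val_pi J_val] := odd_uniformizer hB (val_ge_int hB q) s2' (a := a) (b := b).
- by rewrite a2 s2 addrC.
- by rewrite b2 s2 addrC.
apply: (card_ram_group hB val_pi (s := s) (a := a) (b := b)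
  (J := fun w e1 e2 => if w then 2 else if e1 && e2 then 6 else 4)).
- exact: dim_le8 s2 a2 b2 genL.
- by move=> g g'; apply: eq_gal genL.
- by move=> g; apply: gal_dihedral s2 a2 b2.
- by case=> [] [] [].
move=> g w e1 e2 act_g nz; have := J_val g w e1 e2 act_g nz.
by case: w e1 e2 {act_g nz} => [] [] [].
Qed.

Lemma card_ram_even (k : nat) (m : int) i : (1 <= k)%N -> odd `|m|%N ->
  c = 2 ^+ (2 * k).+1 * m ->
  #|ram_group B i| = (\sum_(w : bool) \sum_(e1 : bool) \sum_(e2 : bool)
    (~~ [|| w, e1 | e2] || (i < if w then if e1 == e2 then 2 else 4
                                else if e1 && e2 then 8 else 2)))%N.
Proof.
move=> k_gt0 m_odd Dc.
have [a [b [s [s2 a2 b2 genL]]]] := splitting_generators hL.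
have t0 : (2 : L) != 0 := two_neq0; have tk0 : (2 : L) ^+ k != 0 := expf_neq0 k t0.
(* Dividing s by 2^k gives s1^2 = -2 m, independent of the power of 2 in c; N is the odd part of
   s1^(2k) = 2^k (-m)^k. *)
pose M : L := m%:~R; pose N : L := (- M) ^+ k; pose p : L := 2 ^+ k; pose s1 := s / p.
have Vm : val_eq B M 0 := val_eq_odd hB m_odd.
have DcL : c%:~R = 2 * p ^+ 2 * M.
  by rewrite Dc rmorphM rmorphXn exprS mulnC exprM.
have s12 : s1 ^+ 2 = - (2 * M) by rewrite expr_div_n s2 DcL; field.
have s10 : s1 != 0.
  have := val_eq_neq0 (val_eq_two hB Vm); apply: contraNneq => s10.
  by rewrite -oppr_eq0 -s12 s10 expr0n.
have DN : N = ((- m) ^+ k)%:~R by rewrite rmorphXn rmorphN.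
have n_odd : odd `|((- m) ^+ k)%R|%N by rewrite abszX oddX abszN m_odd orbT.
have Vn : val_eq B N 0 by rewrite DN; apply: val_eq_odd.
have N0 := val_eq_neq0 Vn.
have s1k : (s1 ^+ k) ^+ 2 = p * N.
  by rewrite -exprM mulnC exprM s12 -mulrN exprMn.
have Ds : s = p * s1 by rewrite /s1; field.
have [||||||pi val_pi J_val] := even_uniformizer hB Vm Vn (s := s1) (p := p)
  (a := a / s1 ^+ k) (b := b / (- s1) ^+ k).
- have -> : M - 1 = (m - 1)%:~R by rewrite rmorphB.
  by apply: (val_ge_even hB); lia.
- have -> : N - 1 = ((- m) ^+ k - 1)%:~R by rewrite rmorphB DN.
  by apply: (val_ge_even hB); move: n_odd; move: ((- m) ^+ k) => n; lia.
(* The valuation of 2^k is 8 k, at least 8 because k >= 1. *)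
- apply: (val_ge_le hB _ (val_eq_ge (val_eq_exp hB k (val_eq2 hB)))); lia.
- by rewrite s12; field.
- rewrite expr_div_n s1k a2 DcL.
  have -> : s - 2 * p ^+ 2 * M = p * (s1 * (1 + p * s1)) by rewrite Ds; ring: s12.
  by field; rewrite tk0 N0.
- rewrite expr_div_n -exprM mulnC exprM sqrrN -exprM mulnC exprM s1k b2 DcL.
  have -> : - s - 2 * p ^+ 2 * M = - (p * (s1 * (1 - p * s1))) by rewrite Ds; ring: s12.
  by field; rewrite tk0 N0.
apply: (card_ram_group hB val_pi (s := s1) (a := a / s1 ^+ k) (b := b / (- s1) ^+ k)
  (J := fun w e1 e2 => if w then if e1 == e2 then 2 else 4 else if e1 && e2 then 8 else 2)).
- exact: dim_le8 s2 a2 b2 genL.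
- move=> g g' gs ga gb; apply: eq_gal genL _ _ _.
  + by apply: (@eq_rmorph_div _ g g' s p _ _ gs); rewrite ?rmorphXn ?rmorph_nat.
  + apply: (@eq_rmorph_div _ g g' a _ _ _ ga); first exact: expf_neq0.
    by rewrite rmorphXn [RHS]rmorphXn; congr (_ ^+ _).
  apply: (@eq_rmorph_div _ g g' b _ _ _ gb); first by rewrite expf_neq0 ?oppr_eq0.
  by rewrite rmorphXn [RHS]rmorphXn !rmorphN; congr ((- _) ^+ _).
- move=> g; have [t act_g] := gal_dihedral g s2 a2 b2.
  by exists t; apply: dihedral_act_rescale.
- by case=> [] [] [].
move=> g w e1 e2 act_g nz; have := J_val g w e1 e2 act_g nz.
by case: w e1 e2 {act_g nz} => [] [] [].
Qed.

End Ramification.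

Unset Implicit Arguments.

Theorem theorem1p3 (c : int) (L : splittingFieldType rat)
    (hL : splittingFieldFor 1%VS (map_poly (in_alg L) (fc c)) {:L})
    (B : L -> Prop) (hB : prime_ideal_above2 B) :
  ((c %% 4)%Z = 1 ->
     (#|ram_group B 0| = 8%N /\ #|ram_group B 1| = 8%N /\
         #|ram_group B 2| = 4%N /\ #|ram_group B 3| = 4%N /\
         #|ram_group B 4| = 2%N /\ #|ram_group B 5| = 2%N
       /\ forall i : nat, (6 <= i)%N -> #|ram_group B i| = 1%N)) /\
  (forall (k : nat) (m : int), (1 <= k)%N -> odd `|m|%N ->
     c = (2 ^+ (2 * k).+1) * m ->
     (#|ram_group B 0| = 8%N /\ #|ram_group B 1| = 8%N /\
         #|ram_group B 2| = 4%N /\ #|ram_group B 3| = 4%N /\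
         (forall i : nat, (4 <= i <= 7)%N -> #|ram_group B i| = 2%N)
       /\ forall i : nat, (8 <= i)%N -> #|ram_group B i| = 1%N)).
Proof.
(* In both cases four nontrivial automorphisms have J = 2 and two have J = 4; the central one has J
   = 6 in the first case and J = 8 in the second. *)
split=> [c_mod4 | k m k_gt0 m_odd Dc].
  have cardE i := card_ram_odd hL hB i c_mod4.
  rewrite !cardE !big_bool /=; do 6!split=> //.
  move=> i le6i; have ltF j : (j <= 6)%N -> (i < j)%N = false by lia.
  by rewrite cardE !big_bool /= !ltF.
have cardE i := card_ram_even hL hB i k_gt0 m_odd Dc.
rewrite !cardE !big_bool /=; do 4!split=> //; split.
  by case=> [|[|[|[|[|[|[|[|i]]]]]]]] // _; rewrite cardE !big_bool.
move=> i le8i; have ltF j : (j <= 8)%N -> (i < j)%N = false by lia.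
by rewrite cardE !big_bool /= !ltF.
Qed.
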